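(* Let $C$ be a non-trivial two-coloring of $\mathbb{Z}^d$ with min-width $k$. Then there exist a positive integer $n$ and a Boolean function $f:\{0,1\}^n\to\{0,1\}$ such that $bs(f) \ge d$ and $s(f) \le k \cdot s(C)$.
   Context: A two-coloring $C$ of $\mathbb{Z}^d$ assigns to each lattice point one of two colors, red or blue. $C$ is non-trivial if the origin is red and, for each $i\in\{1,\dots,d\}$, there is at least one blue point on the $i$-th coordinate axis (a point all of whose coordinates other than the $i$-th are zero). The min-width of a non-trivial coloring is the minimum integer $k$ such that, for every one of the $d$ axes, there is a blue point on that axis at distance at most $k$ from the origin. Two points $x,x'\in\mathbb{Z}^d$ are neighbors if $\|x-x'\|=1$, i.e. they differ by $\pm1$ in exactly one coordinate. The sensitivity $s(C,x)$ of a point $x$ is the number of neighbors of $x$ whose color differs from that of $x$, and $s(C)=\max_x s(C,x)$. For $f:\{0,1\}^n\to\{0,1\}$ and $x\in\{0,1\}^n$: for $B\subseteq\{1,\dots,n\}$, $x^B$ denotes $x$ with the bits indexed by $B$ flipped, and $x^i=x^{\{i\}}$. The sensitivity $s(f,x)$ is the number of $i$ with $f(x^i)\neq f(x)$, and $s(f)=\max_x s(f,x)$. A set $B$ is a sensitive block for $x$ if $f(x^B)\ne f(x)$. The block sensitivity $bs(f,x)$ is the maximum number of pairwise disjoint sensitive blocks for $x$, and $bs(f)=\max_x bs(f,x)$. *)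

(* Defs.v *)
From HB Require Import structures.
From mathcomp Require Import all_boot all_order all_algebra.
From mathcomp Require Import boolp.

Set Implicit Arguments.
Unset Strict Implicit.
Unset Printing Implicit Defensive.

Import Order.TTheory GRing.Theory Num.Theory.

Local Open Scope ring_scope.

Notation red := false (only parsing).
Notation blue := true (only parsing).

Definition coloring (d : nat) := 'rV[int]_d -> bool.

Section Colorings.
Variable d : nat.
Implicit Types (C : coloring d) (x y : 'rV[int]_d) (k : nat).

Definition on_axis (i : 'I_d) x : Prop := forall j, j != i -> x 0 j = 0.

Definition nontrivial C : Prop :=
  C 0 = red /\ forall i : 'I_d, exists2 x, on_axis i x & C x = blue.

(* A point of the i-th axis is at distance |x_i| from the origin. *)
Definition blue_within C k : Prop :=
  forall i : 'I_d, exists x, [/\ on_axis i x, C x = blue & (`|x ord0 i| <= k)%N].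

Definition min_width C k : Prop :=
  blue_within C k /\ forall k', blue_within C k' -> (k <= k')%N.

Definition neighbor x y : Prop :=
  exists2 i : 'I_d, `|x 0 i - y 0 i| = 1 & forall j, j != i -> x 0 j = y 0 j.

(* The points x + e_i and x - e_i; see [mem_neighbors] and [uniq_neighbors]. *)
Definition neighbors x : seq 'rV[int]_d :=
  [seq x + (-1) ^+ b *: delta_mx 0 i | i : 'I_d <- enum 'I_d, b : bool <- [:: false; true]].

Lemma mem_neighbors x y : reflect (neighbor x y) (y \in neighbors x).
Proof.
apply: (iffP allpairsP) => [[[i b] /= [_ _ ->]]|[i nxy exy]].
  exists i => [|j ji]; rewrite !mxE eqxx /=.
    by rewrite eqxx mulr1 opprD addrA subrr sub0r normrN normr_sign.
  by rewrite (negPf ji) mulr0 addr0.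
exists (i, y 0 i < x 0 i); split; rewrite ?mem_enum //=.
  by case: (y 0 i < x 0 i).
apply/rowP => j; rewrite !mxE eqxx /=.
have [->|ji] := eqVneq j i; last by rewrite mulr0 addr0 exy.
rewrite mulr1; move: nxy; case: ltP => [lt|le].
  by rewrite ger0_norm ?subr_ge0 ?ltW // expr1 => <-; rewrite opprB addrC subrK.
by rewrite ler0_norm ?subr_le0 // opprB expr0 => <-; rewrite addrC subrK.
Qed.

Lemma uniq_neighbors x : uniq (neighbors x).
Proof.
apply: allpairs_uniq; rewrite ?enum_uniq // => -[i b] [j c] _ _ /= /addrI.
move=> /rowP /(_ i); rewrite !mxE !eqxx /= mulr1.
have [->|ij] := eqVneq i j; last by rewrite mulr0 => /eqP; rewrite signr_eq0.
by rewrite mulr1 => /eqP; rewrite (inj_eq signr_inj) => /eqP ->.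
Qed.

Definition color_sens_at C x : nat := count (fun y => C y != C x) (neighbors x).

Definition color_sens_val C (s : nat) : bool :=
  `[< exists x, color_sens_at C x = s >].

Lemma color_sens_val_ex C : exists s, color_sens_val C s.
Proof. by exists (color_sens_at C 0); apply/asboolP; exists 0. Qed.

Lemma color_sens_val_le C s : color_sens_val C s -> (s <= d * 2)%N.
Proof.
move=> /asboolP[x <-]; apply: leq_trans (count_size _ _) _.
by rewrite size_allpairs size_enum_ord.
Qed.

Definition color_sens C : nat :=
  ex_maxn (color_sens_val_ex C) (@color_sens_val_le C).

End Colorings.

Section BooleanFunctions.
Variable n : nat.
Implicit Types (f : {ffun 'I_n -> bool} -> bool) (x : {ffun 'I_n -> bool}).

Definition flip x (B : {set 'I_n}) : {ffun 'I_n -> bool} :=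
  [ffun i => x i (+) (i \in B)].

Definition sens_at f x : nat := #|[set i | f (flip x [set i]) != f x]|.

Definition sens f : nat := (\max_x sens_at f x)%N.

Definition sensitive_block f x (B : {set 'I_n}) : bool := f (flip x B) != f x.

(* Families of blocks as sets of sets lose nothing: the empty block is never
   sensitive, so pairwise disjoint sensitive blocks are distinct. *)
Definition block_sens_at f x : nat :=
  (\max_(P : {set {set 'I_n}} |
         trivIset P && [forall B in P, sensitive_block f x B]) #|P|)%N.

Definition block_sens f : nat := (\max_x block_sens_at f x)%N.

End BooleanFunctions.

(* Main.v *)
Require Import Defs.
From mathcomp Require Import all_boot all_order all_algebra.
From mathcomp Require Import boolp.

(** Choose on each axis [i] a blue point at distance [w i <= k] and let [sg i] be
    the sign of its coordinate.  Split the [d * k] input bits into [d] groups of [k]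
    and send an input to the lattice point whose [i]-th coordinate is, up to
    [sg i], the number of ones in the [i]-th group; [f] is the color of that
    point.  Flipping one bit moves to a neighbor, and a given neighbor is
    reached by at most [k] bits.  At the zero input, any [w i] bits of group [i]
    form a sensitive block. *)

Set Implicit Arguments.
Unset Strict Implicit.
Unset Printing Implicit Defensive.

Import Order.TTheory GRing.Theory Num.Theory.
Local Open Scope ring_scope.

Lemma color_sens_at_le d (C : coloring d) p : (color_sens_at C p <= color_sens C)%N.
Proof.
rewrite /color_sens; case: ex_maxnP => m _; apply.
by apply/asboolP; exists p.
Qed.

(** Indexing the neighbors by direction and sign prepares the comparison, neighbor by neighbor, with
    the sensitive bits of an input. *)
Lemma color_sens_at_sum d (C : coloring d) p :
  color_sens_at C p =
  (\sum_(u : 'I_d * bool) (C (p + (-1) ^+ u.2 *: delta_mx 0 u.1)%R != C p))%N.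
Proof.
rewrite -(pair_bigA _ (fun i b => nat_of_bool
  (C (p + (-1) ^+ nat_of_bool b *: delta_mx 0 i) != C p))) /=.
rewrite /color_sens_at /neighbors -sum1_count big_mkcond big_allpairs_dep.
rewrite big_enum_cond /=; apply: eq_bigr => i _.
rewrite big_cons big_seq1 big_bool addnC.
by do 2 case: (_ != _).
Qed.

Section GroupedBits.
Variables (d n : nat) (g : 'I_n -> 'I_d) (sg : 'I_d -> bool).
Implicit Types (x : {ffun 'I_n -> bool}) (C : coloring d).

Definition lattice_point x : 'rV[int]_d :=
  \row_i ((-1) ^+ sg i * (\sum_(t | g t == i) x t)%N%:Z).

(** Turning a bit on moves one step in the direction [sg (g t)], turning it off moves one step back;
    hence the xor in the exponent. *)
Lemma lattice_point_flip1 x t :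
  lattice_point (flip x [set t]) =
  lattice_point x + (-1) ^+ (x t (+) sg (g t)) *: delta_mx 0 (g t).
Proof.
apply/rowP => i; rewrite !mxE eqxx /= eq_sym.
have [<-|gti] := eqVneq (g t) i; last first.
  rewrite mulr0 addr0; congr (_ * _%:Z); apply: eq_bigr => u /eqP gu.
  by rewrite ffunE inE; case: eqP => [ut|_]; rewrite ?addbF //; case/eqP: gti; rewrite -ut.
rewrite mulr1 !(bigD1 t (P := fun u => g u == g t)) //= ffunE inE eqxx addbT.
have -> : (\sum_(u | (g u == g t) && (u != t)) flip x [set t] u =
           \sum_(u | (g u == g t) && (u != t)) x u)%N.
  by apply: eq_bigr => u /andP[_ /negPf ut]; rewrite ffunE inE ut addbF.
rewrite !PoszD !mulrDr addrAC; congr (_ + _).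
by case: (x t); case: (sg _).
Qed.

Lemma sens_lattice_point_le C k :
  (forall i, (#|[set t | g t == i]| <= k)%N) ->
  (sens (C \o lattice_point) <= k * color_sens C)%N.
Proof.
move=> gk; apply/bigmax_leqP => x _.
apply: leq_trans (leq_mul (leqnn k) (color_sens_at_le C (lattice_point x))).
(* [u t] encodes the neighbor reached by flipping [t]. The sensitive bits are sorted by this value:
   a fiber lies within one group, and it is empty when the neighbor has the color of the point. *)
pose u t := (g t, x t (+) sg (g t)).
rewrite color_sens_at_sum /sens_at -sum1dep_card (partition_big u predT) //= big_distrr.
apply: leq_sum => -[i b] _ /=; have [Cp|Cp] := boolP (C _ != C _).
  rewrite muln1; apply: leq_trans (gk i); rewrite sum1dep_card.
  by apply/subset_leq_card/subsetP => t; rewrite !inE => /andP[_ /eqP[->]].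
rewrite muln0 big1 // => t /andP[+ /eqP[gt ut]].
by rewrite lattice_point_flip1 ut gt (negPf Cp).
Qed.

Lemma lattice_point0 : lattice_point [ffun=> false] = 0.
Proof.
by apply/rowP => i; rewrite !mxE big1 ?mulr0 // => t _; rewrite ffunE.
Qed.

Lemma lattice_point_block (i : 'I_d) (B : {set 'I_n}) :
  (forall t, t \in B -> g t = i) ->
  lattice_point (flip [ffun=> false] B) =
  ((-1) ^+ sg i * #|B|%:Z) *: delta_mx 0 i.
Proof.
move=> gB; apply/rowP => j; rewrite !mxE eqxx /=.
have [->|ji] := eqVneq j i; last first.
  rewrite mulr0 big1 ?mulr0 // => t /eqP gt; rewrite !ffunE /=.
  by case: (boolP (t \in B)) => // /gB gi; rewrite -gt gi eqxx in ji.
rewrite mulr1; congr (_ * _%:Z); rewrite -sum1_card big_mkcond [RHS]big_mkcond /=.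
apply: eq_bigr => t _; rewrite !ffunE /=.
by case: (boolP (t \in B)) => [/gB ->|_]; rewrite ?eqxx //; case: ifP.
Qed.

End GroupedBits.

(** A sensitive block is nonempty, so disjointness makes [B] injective and its image has exactly [d]
    members. *)
Lemma block_sens_ge d n (f : {ffun 'I_n -> bool} -> bool) x (B : 'I_d -> {set 'I_n}) :
  (forall i, sensitive_block f x (B i)) ->
  (forall i j, i != j -> [disjoint B i & B j]) ->
  (d <= block_sens f)%N.
Proof.
move=> sB dB; apply: leq_trans (leq_bigmax x); rewrite /block_sens_at.
have B0 i : B i != set0.
  apply/eqP => Bi; move: (sB i); rewrite /sensitive_block Bi.
  suff -> : flip x set0 = x by rewrite eqxx.
  by apply/ffunP => t; rewrite ffunE inE addbF.
have injB : injective B.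
  move=> i j eB; apply/eqP; apply: contraT => /dB.
  by rewrite eB -setI_eq0 setIid (negPf (B0 j)).
have <- : #|B @: [set: 'I_d]| = d by rewrite card_imset // cardsT card_ord.
apply: (@leq_bigmax_cond _ _ (fun P : {set {set 'I_n}} => #|P|)).
apply/andP; split.
  apply/trivIsetP => _ _ /imsetP[i _ ->] /imsetP[j _ ->] Bij.
  by apply: dB; apply: contraNneq Bij => ->.
by apply/forall_inP => _ /imsetP[i _ ->].
Qed.

(** This lets bits be indexed by pairs (group, position) while inputs remain functions on an
    ordinal. *)
Lemma card_enum_val_preim (T : finType) (A : {set T}) :
  #|[set t : 'I_#|T| | enum_val t \in A]| = #|A|.
Proof.
rewrite -[RHS](card_imset _ enum_rank_inj); apply: eq_card => t.
rewrite inE; apply/idP/imsetP => [tA|[a aA ->]]; last by rewrite enum_rankK.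
by exists (enum_val t); rewrite ?enum_valK.
Qed.

Lemma card_ord_lt k w : (w <= k)%N -> #|[set j : 'I_k | (j < w)%N]| = w.
Proof.
by move=> wk; rewrite -sum1dep_card (big_ord_narrow wk) /= sum1_card card_ord.
Qed.

Local Close Scope ring_scope.

Theorem theorem5 (d : nat) (C : coloring d) (k : nat)
    (hC : nontrivial C) (hk : min_width C k) :
  exists n : nat, 0 < n /\
    exists f : {ffun 'I_n -> bool} -> bool,
      d <= block_sens f /\ sens f <= k * color_sens C.
Proof.
have [C0 _] := hC; have [/choice[p pP] _] := hk.
(* For [d = 0] the construction would have no bits, against [0 < n]; a constant function of one bit
   serves instead. *)
have [d0|d_gt0] := posnP d.
  exists 1; split => //; exists (fun=> false); split; first by rewrite d0.
  by apply/bigmax_leqP => x _; rewrite /sens_at (_ : [set _ | _] = set0) ?cards0 //.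
pose w i := `|p i ord0 i|%N; pose sg i := (p i ord0 i < 0)%R.
have pE i : p i = (((-1) ^+ sg i * (w i)%:Z) *: delta_mx 0 i)%R.
  have [pi _ _] := pP i; apply/rowP => j; rewrite !mxE eqxx /=.
  have [->|ji] := eqVneq j i; last by rewrite pi // mulr0.
  by rewrite mulr1 -intEsign.
have Cp i : C (p i) = true by have [] := pP i.
have wk i : w i <= k by have [] := pP i.
(* If [w] vanished on an axis, its blue point would be the origin, which is red. *)
have k_gt0 : 0 < k.
  apply: leq_trans (wk (Ordinal d_gt0)); rewrite lt0n.
  apply/eqP => w0; move: (Cp (Ordinal d_gt0)).
  by rewrite pE w0 mulr0 scale0r C0.
pose T := ('I_d * 'I_k)%type; pose g (t : 'I_#|{: T}|) : 'I_d := (enum_val t).1.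
exists #|{: T}|; split; first by rewrite card_prod !card_ord muln_gt0 d_gt0.
exists (C \o lattice_point g sg); split; last first.
  apply: sens_lattice_point_le => i.
  have -> : [set t | g t == i] = [set t | enum_val t \in setX [set i] [set: 'I_k]].
    by apply/setP => t; rewrite !inE andbT.
  by rewrite card_enum_val_preim cardsX cards1 cardsT card_ord mul1n.
(* The first [w i] positions of group [i]; there are that many because [w i <= k]. Flipping them at
   the zero input leads to [p i]. *)
pose B (i : 'I_d) : {set 'I_#|{: T}|} :=
  [set t | enum_val t \in setX [set i] [set j : 'I_k | j < w i]].
have gB (i : 'I_d) (t : 'I_#|{: T}|) : t \in B i -> g t = i by rewrite !inE => /andP[/eqP].
apply: (@block_sens_ge _ _ _ [ffun=> false] B) => [i|i j ij].
  rewrite /sensitive_block /= lattice_point0 (lattice_point_block sg (gB i)).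
  by rewrite card_enum_val_preim cardsX cards1 mul1n card_ord_lt // -pE Cp C0.
rewrite -setI_eq0; apply/eqP/setP => t; rewrite in_set0 in_setI.
by apply/negP => /andP[/gB ti /gB tj]; case/eqP: ij; rewrite -ti tj.
Qed.
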